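(* Let $G=(V,E)$ be a ribbon graph, let $D(G)$ be its ribbon-graphic delta-matroid, and let $(\boldsymbol\alpha,\boldsymbol\beta,\boldsymbol\gamma)=\{(\alpha_e,\beta_e,\gamma_e): e\in E\}$ be a weight system with entries in a commutative ring $R$ with unity. Then $$Q(G;(\boldsymbol\alpha,\boldsymbol\beta,\boldsymbol\gamma),t)=t^{k(G)}\,Q_{(\boldsymbol\beta,\boldsymbol\alpha,\boldsymbol\gamma)}(D(G);t),$$ where $k(G)$ is the number of connected components of $G$.
   Context: A ribbon graph $G=(V,E)$ is a surface with boundary represented as the union of two (finite) sets of discs, a set $V=V(G)$ of vertices and a set $E=E(G)$ of edges, such that: the vertices and edges intersect in disjoint line segments; each such line segment lies on the boundary of precisely one vertex and precisely one edge; and every edge contains exactly two such line segments. $f(G)$ denotes the number of boundary components of $G$; $G\setminus B$ is the ribbon graph obtained by deleting the edges in $B$ (keeping all vertices). For $C\subseteq E$ the partial Petrial $G^{\tau(C)}$ is obtained from $G$ by, for each $e\in C$, choosing one of the two arcs where $e$ meets a vertex, detaching $e$ along that arc, and reattaching it with the direction of the arc reversed (adding a half-twist to $e$). A quasi-tree is a ribbon graph with exactly one boundary component. The delta-matroid of $G$ is $D(G)=(E,\mathcal{F})$ where $\mathcal{F}$ consists of the edge sets of the spanning ribbon subgraphs of $G$ that form a quasi-tree when restricted to each connected component of $G$. A set system is a pair $D=(E,\mathcal{F})$ with $E$ a finite set and $\mathcal{F}$ a collection of subsets of $E$ (feasible sets). A delta-matroid is a set system with $\mathcal{F}\ne\emptyset$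 such that for all $X,Y\in\mathcal{F}$ and $u\in X\bigtriangleup Y$ there is $v\in X\bigtriangleup Y$ (possibly $v=u$) with $X\bigtriangleup\{u,v\}\in\mathcal{F}$. For $A\subseteq E$ the twist is $D*A=(E,\{A\bigtriangleup X:X\in\mathcal{F}\})$. For $e\in E$, $D+e=(E,\mathcal{F}\bigtriangleup\{F\cup\{e\}:F\in\mathcal{F},e\notin F\})$, and $D+\{e_1,\dots,e_n\}=D+e_1+\cdots+e_n$ (loop complementation; order immaterial). The dual pivot is $D\bar{*}A=((D*A)+A)*A$. Operations are applied from left to right. A delta-matroid is vf-safe if every sequence of twists and loop complementations applied to it results in a delta-matroid; delta-matroids of ribbon graphs are known to be vf-safe. $d_D$ is the rank of the lower matroid $D_{\min}$, i.e. the minimum cardinality of a feasible set of $D$. $\mathcal{P}_3(E)$ is the set of ordered partitions $(A,B,C)$ of $E$ into three, possibly empty, blocks. A weight system is a family of triples $(\alpha_e,\beta_e,\gamma_e)$ of elements of $R$ indexed by $E$; $(\boldsymbol\beta,\boldsymbol\alpha,\boldsymbol\gamma)$ denotes the weight system with triples $(\beta_e,\alpha_e,\gamma_e)$. Topological transition polynomial of a ribbon graph: $$Q(G;(\boldsymbol\alpha,\boldsymbol\beta,\boldsymbol\gamma),t)=\sum_{(A,B,C)\in\mathcal{P}_3(E(G))}\Big(\prod_{e\in A}\alpha_e\Big)\Big(\prod_{e\in B}\beta_e\Big)\Big(\prod_{e\in C}\gamma_e\Big)t^{f(G^{\tau(C)}\setminus B)}\in R[t].$$ Transition polynomial of a vf-safe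 delta-matroid $D=(E,\mathcal{F})$: $$Q_{(\boldsymbol\alpha,\boldsymbol\beta,\boldsymbol\gamma)}(D;t)=\sum_{(A,B,C)\in\mathcal{P}_3(E)}\Big(\prod_{e\in A}\alpha_e\Big)\Big(\prod_{e\in B}\beta_e\Big)\Big(\prod_{e\in C}\gamma_e\Big)t^{d_{D*B\bar{*}C}}.$$ *)

(* Defs.v *)
From HB Require Import structures.
From mathcomp Require Import all_boot all_order all_algebra.
Set Implicit Arguments.
Unset Strict Implicit.
Unset Printing Implicit Defensive.
Import GRing.Theory.
Local Open Scope ring_scope.

(* Ribbon graphs as gluing data.  The edge disc e is the square [0,1] x [0,1];
   it meets the vertices in the two opposite sides {0} x [0,1] and
   {1} x [0,1], which are the segments (e, false) and (e, true).
   The boundary circle of the vertex disc v, with a chosen orientation, carries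
   the segments listed in cyclic order by [rot v].  A segment (e, b) is glued
   in one of two directions: following the orientation of the vertex it runs
   from its end of height [dir (e, b)] to its end of height
   [~~ dir (e, b)].  The first axiom says that each of the two segments of an
   edge lies on precisely one vertex, where it occurs once.  V and E are
   ambient types, so that subgraphs of G have the same type as G; the value of
   [dir] is irrelevant outside [eset]. *)
Record ribbon_graph (V E : finType) := RibbonGraph {
  vset : {set V};
  eset : {set E};
  rot : V -> seq (E * bool);
  dir : E * bool -> bool;
  rot_count : forall h : E * bool,
    (\sum_v count_mem h (rot v))%N = nat_of_bool (h.1 \in eset);
  rot_out : forall v, v \notin vset -> rot v = [::]
}.

(* A corner ((e, b), y) is the end of height y of the segment (e, b). *)
Definition edge_side (E : finType) (x y : E * bool * bool) : bool :=
  [&& x.1.1 == y.1.1, x.1.2 != y.1.2 & x.2 == y.2].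

(* The arc of a vertex circle from the end of one segment to the beginning of
   the next one; both belong to the same segment if it is alone on its vertex,
   since then [next (rot v) h = h]. *)
Definition vertex_arc (V E : finType) (G : ribbon_graph V E)
    (x y : E * bool * bool) : bool :=
  [exists v, [&& x.1 \in rot G v, y.1 == next (rot G v) x.1,
                 x.2 == ~~ dir G x.1 & y.2 == dir G y.1]].

Definition boundary_rel (V E : finType) (G : ribbon_graph V E) :
    rel (E * bool * bool) :=
  fun x y => [|| edge_side x y, vertex_arc G x y | vertex_arc G y x].

(* The number f(G) of boundary components: the second term counts the boundary
   circles of the isolated vertices, which carry no corner. *)
Definition nb_boundary (V E : finType) (G : ribbon_graph V E) : nat :=
  (n_comp (boundary_rel G) [pred x : E * bool * bool | x.1.1 \in eset G]
   + #|[set v in vset G | rot G v == [::]]|)%N.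

Definition adj (V E : finType) (G : ribbon_graph V E) : rel V :=
  fun u v => [exists h : E * bool,
                (h \in rot G u) && ((h.1, ~~ h.2) \in rot G v)].

Definition nb_components (V E : finType) (G : ribbon_graph V E) : nat :=
  n_comp (adj G) (mem (vset G)).

Definition component (V E : finType) (G : ribbon_graph V E) (v : V) : {set V} :=
  [set w | connect (adj G) v w].


Lemma delete_rot_count (V E : finType) (G : ribbon_graph V E) (B : {set E})
    (h : E * bool) :
  (\sum_v count_mem h [seq x <- rot G v | x.1 \notin B])%N
  = nat_of_bool (h.1 \in eset G :\: B).
Proof.
rewrite inE; case: (boolP (h.1 \in B)) => hB /=.
  by apply: big1 => v _; apply/count_memPn; rewrite mem_filter hB.
rewrite -rot_count; apply: eq_bigr => v _.
rewrite count_filter; apply: eq_count => x /=.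
by case: eqP => // ->.
Qed.

Lemma delete_rot_out (V E : finType) (G : ribbon_graph V E) (B : {set E})
    (v : V) : v \notin vset G -> [seq x <- rot G v | x.1 \notin B] = [::].
Proof. by move/rot_out ->. Qed.

Definition delete (V E : finType) (G : ribbon_graph V E) (B : {set E}) :
    ribbon_graph V E :=
  @RibbonGraph V E (vset G) (eset G :\: B)
    (fun v => [seq x <- rot G v | x.1 \notin B]) (dir G)
    (delete_rot_count G B) (@delete_rot_out V E G B).

(* Each edge e of C is detached along the segment (e, true) and reattached there
   in the reverse direction. *)
Definition partial_petrial (V E : finType) (G : ribbon_graph V E)
    (C : {set E}) : ribbon_graph V E :=
  @RibbonGraph V E (vset G) (eset G) (rot G)
    (fun h => if (h.1 \in C) && h.2 then ~~ dir G h else dir G h)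
    (@rot_count V E G) (@rot_out V E G).

(* The edges of G having both ends on vertices of K. *)
Definition inner_edges (V E : finType) (G : ribbon_graph V E) (K : {set V}) :
    {set E} :=
  [set e in eset G | [forall b, [exists v in K, (e, b) \in rot G v]]].

Definition restrict_rot (V E : finType) (G : ribbon_graph V E) (K : {set V})
    (v : V) : seq (E * bool) :=
  if v \in K then [seq x <- rot G v | x.1 \in inner_edges G K] else [::].

Lemma restrict_rot_count (V E : finType) (G : ribbon_graph V E) (K : {set V})
    (h : E * bool) :
  (\sum_v count_mem h (restrict_rot G K v))%N
  = nat_of_bool (h.1 \in inner_edges G K).
Proof.
case: (boolP (h.1 \in inner_edges G K)) => hK; last first.
  apply: big1 => v _; apply/count_memPn; rewrite /restrict_rot.
  by case: ifP => // _; rewrite mem_filter (negPf hK).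
have := hK; rewrite inE => /andP[hE /forallP/(_ h.2)/exists_inP[w wK]].
rewrite -surjective_pairing => hw.
have := rot_count G h; rewrite hE => <-; apply: eq_bigr => v _.
rewrite /restrict_rot; case: ifP => vK.
  rewrite count_filter; apply: eq_count => x /=.
  by case: eqP => // ->.
apply/esym/count_memPn; apply/negP => hv.
have vw : v != w by apply: contraFneq vK => ->.
have := rot_count G h; rewrite hE (bigD1 w) //= (bigD1 v) //=.
move: hv hw; rewrite -!has_pred1 !has_count.
case: (count_mem h (rot G v)) => // m; case: (count_mem h (rot G w)) => // p.
by rewrite addSn addSn addnS.
Qed.

Lemma restrict_rot_out (V E : finType) (G : ribbon_graph V E) (K : {set V})
    (v : V) : v \notin vset G :&: K -> restrict_rot G K v = [::].
Proof.
rewrite inE /restrict_rot; case: (v \in K); rewrite ?andbT //.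
by move/rot_out ->.
Qed.

Definition restrict (V E : finType) (G : ribbon_graph V E) (K : {set V}) :
    ribbon_graph V E :=
  @RibbonGraph V E (vset G :&: K) (inner_edges G K) (restrict_rot G K) (dir G)
    (restrict_rot_count G K) (@restrict_rot_out V E G K).

Definition quasi_tree (V E : finType) (G : ribbon_graph V E) : bool :=
  nb_boundary G == 1%N.

Definition symdiff (T : finType) (A B : {set T}) : {set T} :=
  (A :\: B) :|: (B :\: A).

Record set_system (E : finType) := SetSystem {
  ground : {set E};
  feasible : {set {set E}};
  feasible_sub : feasible \subset powerset ground
}.

(* In the operations on set systems, elements outside the ground set are
   ignored. *)
Definition twist_feasible (E : finType) (D : set_system E) (A : {set E}) :
    {set {set E}} :=
  [set symdiff (A :&: ground D) X | X in feasible D].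

Lemma twist_sub (E : finType) (D : set_system E) (A : {set E}) :
  twist_feasible D A \subset powerset (ground D).
Proof.
apply/subsetP => _ /imsetP[X XD ->]; rewrite powersetE.
have := subsetP (feasible_sub D) _ XD; rewrite powersetE => /subsetP XE.
apply/subsetP => x; rewrite !inE => /orP[/and3P[]|/andP[_ /XE]] //.
Qed.

Definition twist (E : finType) (D : set_system E) (A : {set E}) :
    set_system E :=
  SetSystem (twist_sub D A).

Definition loopc_feasible (E : finType) (D : set_system E) (e : E) :
    {set {set E}} :=
  if e \in ground D then
    symdiff (feasible D) [set e |: X | X in feasible D & e \notin X]
  else feasible D.

Lemma loopc_sub (E : finType) (D : set_system E) (e : E) :
  loopc_feasible D e \subset powerset (ground D).
Proof.
rewrite /loopc_feasible; case: ifP => eD; last exact: feasible_sub.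
apply/subsetP => Y; rewrite !inE => /orP[/andP[_]|/andP[_]].
  by move/(subsetP (feasible_sub D)); rewrite powersetE.
case/imsetP=> X; rewrite inE => /andP[/(subsetP (feasible_sub D))].
by rewrite powersetE => XD _ ->; rewrite subUset sub1set eD.
Qed.

Definition loopc (E : finType) (D : set_system E) (e : E) : set_system E :=
  SetSystem (loopc_sub D e).

Definition loopc_set (E : finType) (D : set_system E) (A : {set E}) :
    set_system E :=
  foldl (@loopc E) D (enum A).

Definition dual_pivot (E : finType) (D : set_system E) (A : {set E}) :
    set_system E :=
  twist (loopc_set (twist D A) A) A.

(* Every feasible set has at most #|ground D| elements, so this is the minimum
   as soon as there is a feasible set. *)
Definition min_rank (E : finType) (D : set_system E) : nat :=
  \big[minn/#|ground D|]_(X in feasible D) #|X|.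

(* The spanning ribbon subgraph with edge set F is G \ (E(G) \ F). *)
Definition rg_feasible (V E : finType) (G : ribbon_graph V E) :
    {set {set E}} :=
  [set F in powerset (eset G) |
    [forall v in vset G,
       quasi_tree (restrict (delete G (eset G :\: F)) (component G v))]].

Lemma rg_feasible_sub (V E : finType) (G : ribbon_graph V E) :
  rg_feasible G \subset powerset (eset G).
Proof. by apply/subsetP => F; rewrite inE => /andP[]. Qed.

Definition delta_matroid_of (V E : finType) (G : ribbon_graph V E) :
    set_system E :=
  SetSystem (rg_feasible_sub G).

Definition ordered_partition3 (E : finType) (S : {set E})
    (A B C : {set E}) : bool :=
  [&& A :|: B :|: C == S, [disjoint A & B], [disjoint A & C]
    & [disjoint B & C]].

Definition topological_transition (R : comNzRingType) (V E : finType)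
    (G : ribbon_graph V E) (alpha beta gamma : E -> R) : {poly R} :=
  \sum_(p : {set E} * {set E} * {set E} |
        ordered_partition3 (eset G) p.1.1 p.1.2 p.2)
    ((\prod_(e in p.1.1) alpha e) * (\prod_(e in p.1.2) beta e)
       * (\prod_(e in p.2) gamma e))
    *: 'X^(nb_boundary (delete (partial_petrial G p.2) p.1.2)).

Definition transition (R : comNzRingType) (E : finType) (D : set_system E)
    (alpha beta gamma : E -> R) : {poly R} :=
  \sum_(p : {set E} * {set E} * {set E} |
        ordered_partition3 (ground D) p.1.1 p.1.2 p.2)
    ((\prod_(e in p.1.1) alpha e) * (\prod_(e in p.1.2) beta e)
       * (\prod_(e in p.2) gamma e))
    *: 'X^(min_rank (dual_pivot (twist D p.1.2) p.2)).

(* Main.v *)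
From HB Require Import structures.
From mathcomp Require Import all_boot all_order all_algebra.
From mathcomp Require Import zify.
Require Import Defs.
Set Implicit Arguments.
Unset Strict Implicit.
Unset Printing Implicit Defensive.
Import GRing.Theory.

(** Both polynomials are sums over the ordered partitions of the edge set, and
    exchanging the first two blocks makes the weights agree.  What remains is an
    identity between exponents,
      f(G^tau(C) \ B) = k(G) + d(D(G) * A dual-pivoted on C).

    A choice of A, B or C for each edge is a state of G.  The corners of the
    edges are joined in pairs by the arcs of the vertex circles, and each edge
    joins its own four corners in pairs in one of three ways: along its sides
    (block A), along its two end segments (block B), or across (block C).  These
    ways are the nonzero elements of the Klein four-group acting on the corners
    of the edge.  The boundary components of G^tau(C) \ B are the circles so
    obtained, together with the isolated vertices (nb_boundary_minor).

    Cutting one edge open turns the circles through it into two paths, which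
    match its four corners in one of the three ways; closing the paths along
    that matching gives two circles, and along either of the two others gives one
    (path_end_pairing, circles_trichotomy).  So the three states of an edge give
    n, n and n + 1 circles in some order, where n >= k(G).  Two facts follow.

    Say that a state is a quasi-tree state if it has k(G) circles; the feasible
    sets of D(G) are the sets of edges left untouched by such states without
    twisted edges (quasi_tree_components).  Among the three states of an edge, none or two are
    quasi-tree states, so that modulo 2 being one is additive over the sum of
    two states (tree_state_kadd).  Loop complementation adds feasibility of
    X \ e to that of X modulo 2, hence replaces the state of e in X by the third
    one, and twisting exchanges the states of e inside and outside X.  So the
    feasible sets X of any set system obtained from D(G) are again those for
    which a certain state, which depends on X edge by edge, is a quasi-tree state
    (encoded_by); for D(G) * A dual-pivoted on C, the state of the empty set is
    the one given by (A, B, C).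

    Changing the state of one edge changes the number of circles by at most 1.
    If this number exceeds k(G) then some edge meets two circles, and changing
    its state in either way joins them (exists_merging_edge).  Hence the
    least number of edges to change to reach a quasi-tree state is the number of
    circles minus k(G), and this is the rank of the lower matroid
    (min_rank_circles). *)

(** * Counting connected components *)

Definition nb_classes (T : finType) (e : rel T) (a : {set T}) : nat :=
  #|[set fingraph.root e x | x in a]|.

Lemma n_comp_classes (T : finType) (e : rel T) (a : {pred T}) :
  connect_sym e -> closed e a -> n_comp e a = nb_classes e [set x in a].
Proof.
move=> esym acl; rewrite /nb_classes /n_comp_mem -[LHS]cardsE.
congr #|pred_of_set _|; apply/setP=> x; rewrite !inE; apply/andP/imsetP.
  by case=> /eqP rx ax; exists x; rewrite ?inE.
case=> y; rewrite inE => ay ->; split; first exact: roots_root.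
by rewrite -(closed_connect acl (connect_root e y)).
Qed.

Lemma leq_card_imset_kernel (T T1 T2 : finType) (a : {set T}) (g1 : T -> T1)
    (g2 : T -> T2) :
  {in a &, forall x y, g2 x = g2 y -> g1 x = g1 y} ->
  (#|g1 @: a| <= #|g2 @: a|).
Proof.
move=> hg; pose u (z : T2) := [pick x in a | g2 x == z].
suff -> : #|g1 @: a| = #|omap g1 @: (u @: (g2 @: a))|.
  exact: leq_trans (leq_imset_card _ _) (leq_imset_card _ _).
have Some_inj : injective (@Some T1) by move=> ? ? [].
rewrite -(card_imset _ Some_inj) -!imset_comp.
congr #|pred_of_set _|; apply: eq_in_imset => x ax /=.
rewrite /u; case: pickP => [y /andP[ay /eqP hy]|/(_ x)] /=.
  by congr Some; apply: hg.
by rewrite ax eqxx.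
Qed.

Lemma card_imset_kernel (T T1 T2 : finType) (a : {set T}) (g1 : T -> T1)
    (g2 : T -> T2) :
  {in a &, forall x y, g1 x = g1 y <-> g2 x = g2 y} -> #|g1 @: a| = #|g2 @: a|.
Proof.
move=> hg; apply/eqP; rewrite eqn_leq !leq_card_imset_kernel //.
  by move=> x y ax ay /(hg x y ax ay).
by move=> x y ax ay /(hg x y ax ay).
Qed.

Lemma connect_hom (T T' : finType) (e : rel T) (e' : rel T') (a : {set T})
    (h : T -> T') :
  (forall x y, x \in a -> e x y -> y \in a) ->
  (forall x y, x \in a -> e x y -> connect e' (h x) (h y)) ->
  forall x y, x \in a -> connect e x y -> y \in a /\ connect e' (h x) (h y).
Proof.
move=> acl hh x y ax /connectP[p]; elim: p x ax => [|z p IHp] x ax /=.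
  by move=> _ ->.
case/andP=> exz pz ly; have az := acl _ _ ax exz.
have [ay c] := IHp z az pz ly; split=> //.
exact: connect_trans (hh _ _ ax exz) c.
Qed.

(** Every class of [e] meeting [a] receives a class of [e'], so there are at
    least as many of the latter; two maps like [h], in opposite directions, give
    the equality of the two numbers. *)
Lemma leq_nb_classes (T T' : finType) (e : rel T) (e' : rel T') (a : {set T})
    (a' : {set T'}) (h : T' -> T) :
  connect_sym e -> connect_sym e' ->
  (forall x y, x \in a' -> e' x y -> y \in a') ->
  (forall x y, x \in a' -> e' x y -> connect e (h x) (h y)) ->
  (forall x, x \in a -> exists2 x', x' \in a' & connect e x (h x')) ->
  (nb_classes e a <= nb_classes e' a').
Proof.
move=> es es' acl hh hs; rewrite /nb_classes.
apply: (@leq_trans #|[set fingraph.root e (h x) | x in a']|).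
  apply: subset_leq_card; apply/subsetP => _ /imsetP[x ax ->].
  have [x' ax' c] := hs x ax; apply/imsetP; exists x' => //.
  by apply/eqP; rewrite root_connect.
apply: leq_card_imset_kernel => x y ax ay /eqP; rewrite root_connect // => c.
by apply/eqP; rewrite root_connect //; case: (connect_hom acl hh ax c).
Qed.

(** Joining two classes loses exactly one of them. *)
Lemma nb_classes_merge (T : finType) (e e' : rel T) (a : {set T}) (u v : T) :
  connect_sym e -> connect_sym e' -> subrel e (connect e') ->
  u \in a -> v \in a -> ~~ connect e u v -> connect e' u v ->
  (forall x y, e' x y -> connect e x y \/
     (connect e u x || connect e v x) && (connect e u y || connect e v y)) ->
  nb_classes e a = (nb_classes e' a).+1.
Proof.
move=> es es' sub au av nuv uv he'.
have sub' : subrel (connect e) (connect e') by apply: connect_sub.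
pose S x := connect e u x || connect e v x.
have Sconn x y : connect e x y -> S x -> S y.
  by move=> c /orP[] c'; rewrite /S (connect_trans c' c) ?orbT.
have c'E x y : connect e' x y -> connect e x y \/ S x && S y.
  case/connectP=> p; elim: p x => [|z p IHp] x /=; first by move=> _ ->; left.
  case/andP=> /he' h1 pz /(IHp z pz) [h2|/andP[Sz Sy]].
    case: h1 => [h1|/andP[Sx Sz]]; first by left; apply: connect_trans h1 h2.
    by right; apply/andP; split=> //; apply: Sconn h2 Sz.
  right; case: h1 => [h1|/andP[Sx _]]; apply/andP; split=> //.
  by apply: Sconn Sz; rewrite es.
pose b := [set x in a | ~~ connect e v x].
have bu : u \in b by rewrite inE au es.
have Eb' : [set fingraph.root e' x | x in a] = [set fingraph.root e' x | x in b].
  apply/setP=> z; apply/imsetP/imsetP; case=> x; last first.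
    by rewrite inE => /andP[ax _] ->; exists x.
  move=> ax ->; case vx: (connect e v x); last by exists x; rewrite ?inE ?ax ?vx.
  exists u => //; apply/eqP; rewrite root_connect // es'.
  by apply: connect_trans uv _; apply: sub'.
have Eb : [set fingraph.root e x | x in a] = fingraph.root e v |: [set fingraph.root e x | x in b].
  apply/setP=> z; rewrite in_setU1; apply/imsetP/predU1P.
    case=> x ax ->; case vx: (connect e v x); last first.
      by right; apply/imsetP; exists x; rewrite ?inE ?ax ?vx.
    by left; apply/eqP; rewrite root_connect // es.
  case=> [->|/imsetP[x]]; first by exists v.
  by rewrite inE => /andP[ax _] ->; exists x.
rewrite /nb_classes Eb cardsU1 Eb' -add1n; congr (_ + _).
  rewrite (_ : fingraph.root e v \in _ = false) //; apply/imsetP=> -[x].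
  by rewrite inE => /andP[_ /negP nvx] /eqP; rewrite root_connect.
apply: card_imset_kernel => x y.
rewrite !inE => /andP[ax nx] /andP[ay ny]; split=> /eqP; rewrite root_connect //.
  by move=> c; apply/eqP; rewrite root_connect //; apply: sub'.
move=> /c'E c; apply/eqP; rewrite root_connect //; case: c => //.
rewrite /S (negPf nx) (negPf ny) !orbF => /andP[c1 c2].
by rewrite es in c1; apply: connect_trans c1 c2.
Qed.

(** * Orbits of two involutions *)

Definition invol_rel (T : eqType) (al be : T -> T) : rel T :=
  fun x y => (y == al x) || (y == be x).

Lemma invol_rel_sym (T : finType) (al be : T -> T) :
  involutive al -> involutive be -> connect_sym (invol_rel al be).
Proof.
move=> alK beK; apply: sym_connect_sym => x y.
by rewrite /invol_rel ![y == _]eq_sym (inv_eq alK) (inv_eq beK).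
Qed.

(** The orbit of [p] under the two involutions is a path one of whose ends is
    [p]: as [be] fixes [p], this orbit is the cycle of [p] under [w := be \o al],
    on which [be] acts as the reflection [i |-> - i] of Z/n and [al] as
    [i |-> - 1 - i].  If [al] has no fixed point there, then n is even and [be]
    fixes exactly two points, of index 0 and n/2. *)
Lemma path_end_pairing (T : finType) (al be : T -> T) (p : T) :
  involutive al -> involutive be -> be p = p ->
  (forall x, connect (invol_rel al be) p x -> al x != x) ->
  exists q, [/\ q != p, be q = q, connect (invol_rel al be) p q &
    forall q', q' != p -> be q' = q' -> connect (invol_rel al be) p q' ->
    q' = q].
Proof.
move=> alK beK bp alF; pose w := be \o al.
have winj : injective w by apply: inj_comp; apply: inv_inj.
have winjn n : injective (iter n w).
  by elim: n => //= n IHn x y /winj/IHn.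
(* [be] conjugates [w] to its inverse. *)
have wb i : iter i w (be (iter i w p)) = p.
  elim: i => [|i IHi]; first by rewrite /= bp.
  by rewrite iterSr -[RHS]IHi iterS {2 3}/w /= beK alK.
have orbit_be x : fconnect w p x -> fconnect w p (be x).
  move=> /iter_findex <-; rewrite fconnect_sym //.
  by rewrite -[X in fconnect _ _ X](wb (findex w p x)) fconnect_iter.
have orbE x : connect (invol_rel al be) p x -> fconnect w p x.
  case/connectP=> s ps ->; elim/last_ind: s ps => [|s y IHs] //=.
  rewrite rcons_path last_rcons => /andP[/IHs c /orP[]/eqP->].
    rewrite -[al _]beK; apply: orbit_be.
    exact: connect_trans c (fconnect1 w _).
  exact: orbit_be.
have orbC x : fconnect w p x -> connect (invol_rel al be) p x.
  apply: connect_sub => {}x _ /eqP <-.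
  apply: (@connect_trans _ _ (al x)); apply: connect1; rewrite /invol_rel /=.
    by rewrite eqxx.
  by rewrite eqxx orbT.
have w0 i : i < order w p -> iter i w p = p -> i = 0.
  move=> ltin ip; rewrite -(findex_iter ltin) ip.
  by apply/eqP; rewrite findex_eq0.
(* A fixed point of [be] of index [i] satisfies [2 i = 0] modulo the order. *)
have fixE q : q != p -> be q = q -> connect (invol_rel al be) p q ->
    q = iter (order w p)./2 w p.
  move=> qp bq /orbE c; rewrite -(iter_findex c); congr (iter _ w p).
  have := findex_max c; set i := findex w p q => ltin.
  have ip : iter (i + i) w p = p.
    by rewrite iterD (iter_findex c) -bq -[X in be X](iter_findex c) wb.
  have i0 : i != 0 by rewrite findex_eq0 eq_sym.
  case: (ltnP (i + i) (order w p)) => [lt2|le2].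
    by have := w0 _ lt2 ip; lia.
  move: ip; rewrite -(subnK le2) iterD iter_order // => /w0; lia.
(* If the order were [2 j + 1], then [al] would fix the point of index [j]. *)
have nodd : ~~ odd (order w p).
  apply/negP => on; pose j := (order w p)./2.
  have nE : order w p = j.+1 + j by rewrite /j; lia.
  have cj : connect (invol_rel al be) p (iter j w p).
    by apply: orbC; apply: fconnect_iter.
  have /negP := alF _ cj; apply; apply/eqP.
  have -> : al (iter j w p) = be (iter j.+1 w p) by rewrite /= beK.
  by apply: (winjn j.+1); rewrite wb -iterD -nE iter_order.
have opos := order_gt0 w p.
pose j := (order w p)./2.
have nE : order w p = j + j by rewrite /j; lia.
exists (iter j w p); split; first last.
- by move=> q' *; apply: fixE.
- by apply: orbC; apply: fconnect_iter.
- by apply: (winjn j); rewrite wb -iterD -nE iter_order.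
by apply/eqP => /w0; lia.
Qed.

(** * Darts, corners and points *)

Section Rotation.
Variables (V E : finType) (G : ribbon_graph V E).

Lemma rot_edge v h : h \in rot G v -> h.1 \in eset G.
Proof.
rewrite -has_pred1 has_count /= => hv; have := rot_count G h.
by rewrite (bigD1 v) //=; case: (h.1 \in eset G) => //; lia.
Qed.

Lemma edge_rot h : h.1 \in eset G -> exists v, h \in rot G v.
Proof.
move=> hE; have := rot_count G h; rewrite hE => S1.
case: (pickP (fun v => h \in rot G v)) => [v hv|none]; first by exists v.
have : \sum_v count_mem h (rot G v) = 0.
  by apply: big1 => v _; apply/count_memPn; rewrite none.
by rewrite S1.
Qed.

Lemma rotation_inj h u v : h \in rot G u -> h \in rot G v -> u = v.
Proof.
rewrite -!has_pred1 !has_count /= => hu hv; apply/eqP; case: eqP => // /eqP uv.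
have := rot_count G h; rewrite (bigD1 u) //= (bigD1 v) 1?eq_sym //=.
by case: (h.1 \in eset G); lia.
Qed.

Lemma rotation_uniq v : uniq (rot G v).
Proof.
apply: count_mem_uniq => h; case: (boolP (h \in rot G v)) => [|/count_memPn//].
rewrite -has_pred1 has_count /= => hv; have := rot_count G h.
by rewrite (bigD1 v) //=; case: (h.1 \in eset G) => /=; lia.
Qed.

Lemma rot_vset h v : h \in rot G v -> v \in vset G.
Proof. by apply: contraTT => /rot_out ->. Qed.

Definition dart_vertex (h : E * bool) : option V := [pick v | h \in rot G v].

Lemma dart_vertexE h v : h \in rot G v -> dart_vertex h = Some v.
Proof.
rewrite /dart_vertex => hv; case: pickP => [u hu|/(_ v)]; last by rewrite hv.
by rewrite (rotation_inj hu hv).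
Qed.

Lemma dart_vertex_None h : h.1 \notin eset G -> dart_vertex h = None.
Proof.
move=> hE; rewrite /dart_vertex; case: pickP => // v /rot_edge.
by rewrite (negPf hE).
Qed.

Variant dart_vertex_spec (h : E * bool) : option V -> Type :=
  | DartOn v of h \in rot G v & h.1 \in eset G : dart_vertex_spec h (Some v)
  | DartOff of h.1 \notin eset G : dart_vertex_spec h None.

Lemma dart_vertexP h : dart_vertex_spec h (dart_vertex h).
Proof.
case: (boolP (h.1 \in eset G)) => hE; last first.
  by rewrite dart_vertex_None //; constructor.
case E1: (dart_vertex h) => [v|].
  by constructor=> //; move: E1; rewrite /dart_vertex; case: pickP => // u hu [<-].
by exfalso; have [v /dart_vertexE] := edge_rot hE; rewrite E1.
Qed.

Definition next_dart (h : E * bool) : E * bool :=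
  if dart_vertex h is Some v then next (rot G v) h else h.

Definition prev_dart (h : E * bool) : E * bool :=
  if dart_vertex h is Some v then prev (rot G v) h else h.

Lemma next_dartE h v : h \in rot G v -> next_dart h = next (rot G v) h.
Proof. by rewrite /next_dart => /dart_vertexE ->. Qed.

Lemma next_dart_rot h v : h \in rot G v -> next_dart h \in rot G v.
Proof. by move=> hv; rewrite (next_dartE hv) mem_next. Qed.

Lemma next_dartK : cancel next_dart prev_dart.
Proof.
move=> h; case Eh: _ / (dart_vertexP h) => [v hv _|_].
  rewrite /prev_dart (dart_vertexE (next_dart_rot hv)) (next_dartE hv).
  by rewrite prev_next // rotation_uniq.
by rewrite /prev_dart /next_dart Eh Eh.
Qed.

Lemma prev_dartK : cancel prev_dart next_dart.
Proof.
move=> h; case Eh: _ / (dart_vertexP h) => [v hv _|_].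
  have ph : prev_dart h \in rot G v by rewrite /prev_dart Eh mem_prev.
  by rewrite (next_dartE ph) /prev_dart Eh next_prev // rotation_uniq.
by rewrite /prev_dart /next_dart Eh Eh.
Qed.

Lemma iter_next_dart_rot n h v : h \in rot G v -> iter n next_dart h \in rot G v.
Proof. by move=> hv; elim: n => //= n; apply: next_dart_rot. Qed.

Lemma next_dart_cycle v : fcycle next_dart (rot G v).
Proof.
have := cycle_next (rotation_uniq v).
rewrite (eq_in_cycle (P := mem (rot G v)) (e' := frel next_dart)) //.
  by move=> x y xv _; rewrite /= (next_dartE xv).
Qed.

Lemma fconnect_next_dart h v : h \in rot G v ->
  forall h', fconnect next_dart h h' = (h' \in rot G v).
Proof. by move=> hv h'; have /(_ h hv h') := fconnect_cycle (next_dart_cycle v). Qed.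

(** * The states of a ribbon graph *)

Definition corner : finType := (E * bool * bool)%type.
(** The vertices are added for the sake of the isolated ones, whose boundary
    circles carry no corner. *)
Definition point : finType := (corner + V)%type.

Definition points : {set point} :=
  [set x | match x with
           | inl c => c.1.1 \in eset G
           | inr v => (v \in vset G) && (rot G v == [::])
           end].

(** Exchanges the two ends of each vertex arc. *)
Definition arc_flip (x : point) : point :=
  match x with
  | inl (h, y) => if y == ~~ dir G h then inl (next_dart h, dir G (next_dart h))
                  else inl (prev_dart h, ~~ dir G (prev_dart h))
  | inr v => inr v
  end.

Lemma arc_flipK : involutive arc_flip.
Proof.
case=> // -[h y]; rewrite {2}/arc_flip; case: (eqVneq y (~~ dir G h)) => [->|hy] /=.
  by rewrite next_dartK; case: (dir G (next_dart h)).
by rewrite eqxx prev_dartK; move: hy; case: y; case: (dir G h).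
Qed.

Lemma arc_flip_corner c : arc_flip (inl c) != inl c.
Proof.
case: c => h y /=; case: (eqVneq y (~~ dir G h)) => [->|hy]; apply/eqP => -[Eh].
  by rewrite Eh; case: (dir G h).
by rewrite Eh => Ey; move: hy; rewrite -Ey eqxx.
Qed.

(** The group law of the Klein four-group: the sum of two distinct nonzero
    elements is the third one. *)
Definition kadd (z w : bool * bool) : bool * bool := (z.1 (+) w.1, z.2 (+) w.2).

(** The state of an edge is the translation that joins its corners in pairs:
    [(true, false)] is the edge as it stands, [(false, true)] the deleted edge,
    along whose end segments the vertex circle now runs, [(true, true)] the
    edge with a half-twist added.  In the state [(false, false)] the edge is cut
    open and its corners are left single. *)
Definition state : finType := {ffun E -> bool * bool}.

Definition edge_flip (s : state) (x : point) : point :=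
  match x with
  | inl (e, b, y) => inl (e, b (+) (s e).1, y (+) (s e).2)
  | inr v => inr v
  end.

Lemma edge_flipK s : involutive (edge_flip s).
Proof. by case=> // -[[e b] y] /=; rewrite !addbK. Qed.

Definition state_rel (s : state) : rel point := invol_rel arc_flip (edge_flip s).

Lemma state_rel_sym s : connect_sym (state_rel s).
Proof. exact: invol_rel_sym arc_flipK (edge_flipK s). Qed.

Definition nb_circles (s : state) : nat := nb_classes (state_rel s) points.

Lemma prev_dart_edge h : ((prev_dart h).1 \in eset G) = (h.1 \in eset G).
Proof.
rewrite /prev_dart; case: (dart_vertexP h) => [v hv hE|//].
by rewrite hE; apply: (@rot_edge v); rewrite mem_prev.
Qed.

Lemma next_dart_edge h : ((next_dart h).1 \in eset G) = (h.1 \in eset G).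
Proof. by rewrite -[h in RHS]next_dartK prev_dart_edge. Qed.

Lemma arc_flip_points x : (arc_flip x \in points) = (x \in points).
Proof.
case: x => // -[h y]; rewrite /arc_flip.
by case: ifP => _; rewrite !inE /= (next_dart_edge, prev_dart_edge).
Qed.

Lemma state_rel_points s x y : x \in points -> state_rel s x y -> y \in points.
Proof.
move=> xp /orP[]/eqP->; first by rewrite arc_flip_points.
by case: x xp => // -[[e b] z]; rewrite !inE.
Qed.

(** * Changing the state of one edge *)

Definition set_state (s : state) e z : state :=
  [ffun e' => if e' == e then z else s e'].

Definition edge_corner (e : E) (z : bool * bool) : point := inl (e, z.1, z.2).

(** If the edge [e] is cut open, the four corners of [e] are the ends of two
    paths; [m] is the matching of the corners given by these paths.  Gluing [e]
    back along [m] closes both paths into separate circles, and gluing along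
    another matching closes them into a single circle. *)
Lemma circles_trichotomy (s : state) e : e \in eset G ->
  (forall e', s e' != (false, false)) ->
  exists2 m, m != (false, false) & exists n, forall z, z != (false, false) ->
    nb_circles (set_state s e z) = n + (z == m) /\
    (z != m -> forall x y, connect (state_rel (set_state s e z))
                             (edge_corner e x) (edge_corner e y)).
Proof.
move=> eE s0.
pose s' := set_state s e (false, false); pose r := state_rel s'; pose K := edge_corner e.
have Kfix x : edge_flip s' (K x) = K x.
  by rewrite /= ffunE eqxx /= !addbF.
have inlC c x : connect r (inl c) x -> exists c', x = inl c'.
  case/connectP=> p; elim: p c => [|z p IHp] c /=; first by move=> _ ->; exists c.
  case/andP=> cz pz l; suff [c' Ez] : exists c', z = inl c'.
    by move: pz l; rewrite Ez; apply: IHp.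
  case: c cz => -[e' b] y /orP[]/eqP->; last by eexists.
  by rewrite /arc_flip; case: ifP => _; eexists.
have fixK c : edge_flip s' (inl c) = inl c -> exists y, inl c = K y.
  case: c => -[e' b] y /= []; rewrite ffunE; case: eqP => [-> _ _|_ Eb Ey].
    by exists (b, y).
  have := s0 e'; case: (s e') Eb Ey => -[] [] /=; rewrite ?addbT ?addbF //.
  - by case: b.
  - by case: b.
  - by move=> _; case: y.
have Kinj : injective K by move=> [? ?] [? ?] [-> ->].
(* All other edges being in proper states, the fixed points of [edge_flip s']
   among the corners are the four corners of [e]. *)
have partner x : exists2 y, y != x & forall y', y' != x ->
    connect r (K x) (K y') = (y' == y).
  have [|q [qx qf xq qU]] :=
      path_end_pairing arc_flipK (edge_flipK s') (Kfix x).
    by move=> y /inlC[c ->]; apply: arc_flip_corner.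
  have [c Eq] := inlC _ _ xq; rewrite Eq in qf.
  have [y Ey] := fixK c qf; rewrite Ey in Eq.
  exists y; first by move: qx; rewrite Eq (inj_eq Kinj).
  move=> y' y'x; apply/idP/eqP => [c'|->]; last by rewrite -Eq.
  apply: (Kinj); rewrite -Eq; apply: qU; rewrite ?Kfix //.
  by apply: contraNneq y'x => /Kinj ->.
have rs := state_rel_sym s'.
have [m m0 mP] := partner (false, false).
(* The partners of [(0, 0)] and [m] being each other, those of the remaining
   two corners are too. *)
have KE x y : connect r (K x) (K y) = (y == x) || (y == kadd x m).
  have [->|yx] := eqVneq y x; first by rewrite connect0.
  have [y0 y0x y0P] := partner x; rewrite y0P //.
  suff -> : y0 = kadd x m by [].
  have c0m : connect r (K (false, false)) (K m) by rewrite mP.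
  have cxy0 : connect r (K x) (K y0) by rewrite y0P.
  have [Ex|x0] := eqVneq x (false, false).
    have : connect r (K (false, false)) (K y0) by rewrite -Ex.
    by rewrite mP -?Ex // => /eqP ->; rewrite Ex; case: (m).
  have xm : y0 != (false, false) -> x != m.
    move=> y00; apply: contraNneq y0x => Ex; rewrite Ex -mP //.
    by apply: connect_trans c0m _; rewrite -Ex.
  have y0m : y0 = (false, false) -> x = m.
    by move=> Ey; apply/eqP; rewrite -mP // rs -Ey.
  have y0nm : y0 == m -> x = m.
    move=> /eqP Ey; apply/eqP; rewrite -mP //.
    by apply: connect_trans c0m _; rewrite rs -Ey.
  move: xm y0m y0nm y0x x0 m0.
  case: (x) => -[] []; case: (y0) => -[] []; case: (m) => -[] [] //= h1 h2 h3;
    by [have := h1 isT | have := h2 erefl | have := h3 isT].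
exists m => //.
have sub z : subrel r (connect (state_rel (set_state s e z))).
  move=> x y /orP[]/eqP->; first by apply: connect1; rewrite /state_rel /invol_rel eqxx.
  case: x => [[[e' b] w]|v] //=; rewrite ffunE; case: eqP => [->|/eqP e'e].
    by rewrite !addbF.
  by apply: connect1; rewrite /state_rel /invol_rel /= ffunE (negPf e'e) eqxx orbT.
have sup z x y : state_rel (set_state s e z) x y -> connect r x y \/
    exists u, x = K u /\ y = K (kadd u z).
  case/orP=> /eqP->; first by left; apply: connect1; rewrite /r /state_rel /invol_rel eqxx.
  case: x => [[[e' b] w]|v] /=; last by left.
  rewrite ffunE; case: eqP => [->|/eqP e'e]; first by right; exists (b, w).
  by left; apply: connect1; rewrite /r /state_rel /invol_rel /= ffunE (negPf e'e) eqxx orbT.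
have Kpt x : K x \in points by rewrite inE.
have nm : nb_circles (set_state s e m) = nb_circles s'.
  apply/eqP; rewrite eqn_leq; apply/andP; split;
    apply: (@leq_nb_classes _ _ _ _ _ _ id); rewrite -/r //;
    try exact: state_rel_sym; try (by move=> x; exists x); move=> x y.
  - exact: state_rel_points.
  - by move=> _; apply: sub.
  - exact: state_rel_points.
  - by move=> _ /sup[//|[u [-> ->]]]; rewrite KE eqxx orbT.
have nz z : z != (false, false) -> z != m ->
    nb_circles s' = (nb_circles (set_state s e z)).+1.
  move=> z0 zm; apply: (@nb_classes_merge _ _ _ _ (K (false, false)) (K z)) => //.
  - exact: state_rel_sym.
  - by rewrite KE negb_or z0; move: zm; case: (z) => -[] []; case: (m) => -[] [].
  - by apply: connect1; rewrite /state_rel /invol_rel /= ffunE !eqxx orbT.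
  - move=> x y /sup[c|[u [-> ->]]]; [by left|right].
    rewrite -/r !KE; move: z0 zm m0.
    by case: (z) => -[] []; case: (m) => -[] []; case: (u) => -[] [].
exists (nb_circles s').-1 => z z0; split.
  case: eqP => [->|/eqP zm]; last by rewrite (nz z z0 zm) addn0.
  rewrite nm addn1 prednK //; rewrite /nb_circles /nb_classes card_gt0.
  apply/set0Pn; exists (fingraph.root r (K m)); exact: imset_f.
move=> zm x y.
(* The corner [K w] is on the path of [K (0, 0)] or on that of [K z], and these
   two corners are glued. *)
have hub w : connect (state_rel (set_state s e z)) (K (false, false)) (K w).
  have csub := connect_sub (sub z).
  have cz u : connect (state_rel (set_state s e z)) (K u) (K (kadd u z)).
    by apply: connect1; rewrite /state_rel /invol_rel /= ffunE !eqxx orbT.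
  have [c|c] : connect r (K (false,false)) (K w) \/ connect r (K z) (K w).
    rewrite !KE; move: z0 zm m0.
    by case: (z) => -[] []; case: (m) => -[] []; case: (w) => -[] []; auto.
  - exact: csub.
  - by apply: connect_trans (csub _ _ c); have := cz (false, false); case: (z).
by apply: connect_trans (hub y); rewrite state_rel_sym.
Qed.

End Rotation.

(** * Boundary components as circles of a state *)

Section Boundary.
Variables (V E : finType) (G : ribbon_graph V E).
Local Notation point := (point V E).

(** An isolated vertex is related to no point, so that it forms a class, which
    stands for its boundary circle. *)
Definition boundary_point_rel : rel point :=
  fun x y => match x, y with
             | inl c, inl d => boundary_rel G c d
             | _, _ => false
             end.

Lemma boundary_rel_sym : symmetric (boundary_rel G).
Proof.
move=> x y; rewrite /boundary_rel orbA orbAC -orbA; congr (_ || _).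
  by rewrite /edge_side eq_sym (eq_sym x.1.2) (eq_sym x.2).
Qed.

Lemma boundary_point_rel_sym : connect_sym boundary_point_rel.
Proof.
by apply: sym_connect_sym => -[c|v] [d|w] //=; apply: boundary_rel_sym.
Qed.

Lemma boundary_rel_edge c d :
  boundary_rel G c d -> (c.1.1 \in eset G) = (d.1.1 \in eset G).
Proof.
case/or3P=> [/and3P[/eqP-> _ _] //|/existsP[v /and4P[cv /eqP dE _ _]]
            |/existsP[v /and4P[dv /eqP cE _ _]]].
  by rewrite (rot_edge cv) (@rot_edge _ _ G v) // dE mem_next.
by rewrite (rot_edge dv) (@rot_edge _ _ G v) // cE mem_next.
Qed.

Lemma boundary_point_rel_points x y :
  x \in points G -> boundary_point_rel x y -> y \in points G.
Proof.
by case: x => // c; case: y => // d; rewrite !inE => cE /boundary_rel_edge <-.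
Qed.

Lemma nb_boundary_classes :
  nb_boundary G = nb_classes boundary_point_rel (points G).
Proof.
rewrite /nb_boundary n_comp_classes; last 2 first.
- exact: sym_connect_sym boundary_rel_sym.
- by move=> c d; exact: boundary_rel_edge.
pose g (x : point) : point :=
  if x is inl c then inl (fingraph.root (boundary_rel G) c) else x.
pose cs := [set x in [pred x : E * bool * bool | x.1.1 \in eset G]].
have cinl x y : connect boundary_point_rel (inl x) (inl y)
    = connect (boundary_rel G) x y.
  apply/idP/idP.
    case/connectP=> p; elim: p x => [|[z|z] p IHp] x //=; first by move=> _ [->].
    case/andP=> xz pz l; exact: connect_trans (connect1 xz) (IHp z pz l).
  case/connectP=> p; elim: p x => [|z p IHp] x /=; first by move=> _ ->.
  case/andP=> xz pz l; apply: connect_trans (IHp z pz l).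
  exact: connect1.
have cinr v x : connect boundary_point_rel (inr v) x = (x == inr v).
  apply/idP/eqP => [|-> //]; by case/connectP=> -[|y p] //=.
transitivity #|g @: points G|; last first.
  apply: card_imset_kernel => x y _ _.
  have -> : fingraph.root boundary_point_rel x
      = fingraph.root boundary_point_rel y <-> connect boundary_point_rel x y.
    split=> [/eqP|c]; first by rewrite root_connect //; apply: boundary_point_rel_sym.
    by apply/eqP; rewrite root_connect //; apply: boundary_point_rel_sym.
  case: x y => [c|v] [d|w]; rewrite ?cinl ?cinr /=.
  - have sG := sym_connect_sym boundary_rel_sym.
    split=> [[] /eqP|h]; first by rewrite root_connect.
    by congr inl; apply/eqP; rewrite root_connect.
  - by split=> //; rewrite boundary_point_rel_sym cinr.
  - by split.
  - by split=> [->|/eqP ->].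
have -> : g @: points G = (inl @: (fingraph.root (boundary_rel G) @: cs))
      :|: (inr @: [set v in vset G | rot G v == [::]]).
  apply/setP=> x; rewrite in_setU; apply/imsetP/orP.
    case=> -[c|v]; rewrite inE => hx ->; [left|right].
      by apply: imset_f; apply: imset_f; rewrite !inE.
    by apply: imset_f; rewrite inE.
  case=> /imsetP[].
    by move=> _ /imsetP[c cE ->] ->; exists (inl c) => //; move: cE; rewrite !inE.
  by move=> v; rewrite inE => hv ->; exists (inr v); rewrite ?inE.
rewrite cardsU; set I := _ :&: _; have -> : I = set0.
  by apply/setP=> -[c|v]; rewrite !inE; apply/andP=> -[/imsetP[? _ E1] /imsetP[? _ E2]].
by rewrite cards0 subn0 (card_imset _ inl_inj) (card_imset _ inr_inj).
Qed.

End Boundary.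

(** * Rotations after a deletion *)

Lemma orbit_next (T : finType) (f : T -> T) x :
  injective f -> orbit f (f x) = rcons (behead (orbit f x)) x.
Proof.
move=> finj; have oE : order f (f x) = order f x.
  by apply: order_id_cycle; apply: cycle_orbit.
rewrite /orbit oE -{1}orderSpred trajectSr -[in RHS]orderSpred /=; congr rcons.
by rewrite -iterSr orderSpred iter_order.
Qed.

Section FirstDart.
Variables (V E : finType) (G : ribbon_graph V E) (P : pred (E * bool)).

(** The first dart satisfying [P] met after [h] when running around its
    vertex; [h] itself comes last. *)
Definition first_dart (h : E * bool) : option (E * bool) :=
  ohead (filter P (orbit (next_dart G) (next_dart G h))).

Lemma first_dart_next h : first_dart h =
  if P (next_dart G h) then Some (next_dart G h) else first_dart (next_dart G h).
Proof.
have ninj := can_inj (@next_dartK V E G); set f := next_dart G.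
rewrite /first_dart -/f (orbit_next (f h) ninj).
rewrite /orbit -(orderSpred f (f h)) /= filter_rcons.
by case: ifP => // _; rewrite cats0.
Qed.

(** Deleting edges shortcuts the rotation at a vertex. *)
Lemma first_dart_filter v h : h \in rot G v -> P h ->
  first_dart h = Some (next (filter P (rot G v)) h).
Proof.
move=> hv Ph; have u := rotation_uniq G v.
have nv := next_dart_rot hv; rewrite /first_dart.
have [i p Ep] := rot_to hv.
have Ef : exists j, filter P (seq.rot i (rot G v)) = seq.rot j (filter P (rot G v)).
  exists (size (filter P (take i (rot G v)))).
  rewrite -[X in seq.rot _ (filter P X)](cat_take_drop i) [in RHS]filter_cat.
  by rewrite rot_size_cat -filter_cat.
case: Ef => j Ef; rewrite -(next_rot j) ?filter_uniq // -Ef Ep /= Ph.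
have cyc : fcycle (next_dart G) (h :: p) by rewrite -Ep rot_cycle next_dart_cycle.
have up : uniq (h :: p) by rewrite -Ep rot_uniq rotation_uniq.
have -> : orbit (next_dart G) (next_dart G h) = rcons p h.
  rewrite (orbit_next h (can_inj (@next_dartK V E G))).
  by rewrite (orbitE cyc up) ?mem_head //= eqxx rot0.
rewrite filter_rcons Ph; case: (filter P p) => [|d q] /=; by rewrite eqxx.
Qed.

End FirstDart.

(** * Deletion and partial Petrials as states *)

Definition minor_state (E : finType) (B C : {set E}) : state E :=
  [ffun e => if e \in B then (false, true) else (true, e \in C)].

Section Minor.
Variables (V E : finType) (G H : ribbon_graph V E) (B C : {set E}).
Local Notation point := (point V E).
Let kept : pred (E * bool) := fun h => h.1 \notin B.
Let twisted (h : E * bool) := (h.1 \in C) && h.2.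
Hypothesis vsetE : vset H = vset G.
Hypothesis esetE : eset H = eset G :\: B.
Hypothesis rotE : forall v, rot H v = filter kept (rot G v).
Hypothesis dirE : forall h, dir H h = dir G h (+) twisted h.
Let s := minor_state B C.
Local Notation rG := (state_rel G s).
Local Notation rH := (boundary_point_rel H).

(** The half-twist of [e] reverses the segment [(e, true)], which exchanges the
    heights of its two corners.  A vertex isolated in [H] but not in [G] has all
    its corners in [G] on one circle, so that any of them can stand for it. *)
Let up (x : point) : point :=
  match x with
  | inl (h, y) => inl (h, y (+) twisted h)
  | inr v => if rot G v is h :: _ then inl (h, true) else inr v
  end.

(** The end of the arc of [H] that covers the arc of [G] starting at [h]. *)
Let head_point (h : E * bool) : point :=
  match first_dart G kept h, dart_vertex G h with
  | Some d, _ => inl (d, dir H d)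
  | None, Some v => inr v
  | None, None => inl (h, true)
  end.

Let down (x : point) : point :=
  match x with
  | inl (h, y) => if kept h then inl (h, y (+) twisted h) else head_point h
  | inr v => inr v
  end.

Let head_point_next h : h.1 \in eset G ->
  head_point h = down (inl (next_dart G h, dir G (next_dart G h))).
Proof.
rewrite /head_point first_dart_next => hE; rewrite /down.
case: ifP => [_|nk]; first by rewrite dirE.
rewrite /head_point; case: first_dart => //.
have [v hv] := edge_rot hE.
by rewrite (dart_vertexE hv) (dart_vertexE (next_dart_rot hv)).
Qed.

Let down_end h : h.1 \in eset G ->
  connect rH (down (inl (h, ~~ dir G h))) (head_point h).
Proof.
move=> hE; rewrite /down; case: ifP => // kh.
have [v hv] := edge_rot hE.
rewrite /head_point (first_dart_filter hv kh); apply: connect1 => /=.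
apply/or3P; apply: Or32; apply/existsP; exists v => /=.
by rewrite rotE mem_filter kh hv dirE addNb !eqxx.
Qed.

Let rG_sym : connect_sym rG. Proof. exact: state_rel_sym. Qed.
Let rH_sym : connect_sym rH. Proof. exact: boundary_point_rel_sym. Qed.

Let arcG h : rG (inl (h, ~~ dir G h)) (inl (next_dart G h, dir G (next_dart G h))).
Proof. by rewrite /state_rel /invol_rel /arc_flip eqxx eqxx. Qed.

Let down_hom x y : x \in points G -> rG x y -> connect rH (down x) (down y).
Proof.
have arc h : h.1 \in eset G -> connect rH (down (inl (h, ~~ dir G h)))
    (down (inl (next_dart G h, dir G (next_dart G h)))).
  by move=> hE; rewrite -head_point_next //; apply: down_end.
case: x => [[h z]|v] hE; last by move=> /orP[]/eqP->.
move: hE; rewrite inE /= => hE /orP[]/eqP->.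
  rewrite /arc_flip; case: eqP => [->|/eqP zE]; first exact: arc.
  have -> : z = dir G h by move: zE; case: (z); case: (dir G h).
  have := arc (prev_dart G h); rewrite prev_dartK prev_dart_edge rH_sym.
  by apply.
case: h hE => e b /= eE; rewrite /s ffunE; case: (boolP (e \in B)) => eB.
  by rewrite /= addbF /kept /= eB /=.
rewrite /= /kept /= eB; apply: connect1; apply/or3P; apply: Or31.
rewrite /edge_side /twisted /= eqxx.
by case: (e \in C); case: (b); case: (z).
Qed.

Let crossed h y y' : ~~ kept h -> connect rG (inl (h, y)) (inl (h, y')).
Proof.
case: h => e b; rewrite /kept negbK /= => eB; have [->//|yy'] := eqVneq y y'.
apply: connect1; rewrite /state_rel /invol_rel /= ffunE eB /= addbF.
by move: yy'; case: y; case: y' => //=; rewrite eqxx orbT.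
Qed.

(** Along deleted edges a circle of the state follows the circle of the vertex. *)
Let walk n h : (forall i, i < n -> ~~ kept (iter i.+1 (next_dart G) h)) ->
  connect rG (inl (h, ~~ dir G h))
    (inl (iter n.+1 (next_dart G) h, dir G (iter n.+1 (next_dart G) h))).
Proof.
elim: n => [|n IHn] hk; first by apply: connect1; apply: arcG.
apply: connect_trans (IHn _) _ => [i lin|]; first by apply: hk; apply: ltnW.
by apply: connect_trans (crossed _ _ (hk n _)) (connect1 (arcG _)).
Qed.

Let first_dartP h : 
  match first_dart G kept h with
  | Some d => exists n, d = iter n.+1 (next_dart G) h /\
                forall i, i < n -> ~~ kept (iter i.+1 (next_dart G) h)
  | None => forall v d, h \in rot G v -> d \in rot G v -> ~~ kept d
  end.
Proof.
rewrite /first_dart; have ninj := can_inj (@next_dartK V E G).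
case Ef: (filter _ _) => [|d q] /=.
  move=> v d hv dv; have : d \in orbit (next_dart G) (next_dart G h).
    by rewrite -fconnect_orbit (fconnect_next_dart (next_dart_rot hv)).
  move=> dor; apply/negP => kd; have : d \in [::] by rewrite -Ef mem_filter kd.
  by [].
move: Ef; rewrite /orbit; move: (order _ _) => n; elim: n h => //= n IHn h.
case: ifP => [_ [<- _]|nk /IHn[m [-> mP]]]; first by exists 0.
exists m.+1; split; first by rewrite -iterSr.
by case=> [|i] lim; [rewrite /= nk | rewrite iterSr; apply: mP].
Qed.

Let up_head_point h : h.1 \in eset G ->
  connect rG (inl (h, ~~ dir G h)) (up (head_point h)).
Proof.
move=> hE; have [v hv] := edge_rot hE; rewrite /head_point.
have := first_dartP h; case: first_dart => [d [n [-> nP]]|none].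
  rewrite /up dirE addbK; apply: walk => i; exact: nP.
rewrite (dart_vertexE hv) /=; case Er: (rot G v) => [|d p].
  by move: hv; rewrite Er.
have dv : d \in rot G v by rewrite Er mem_head.
have : fconnect (next_dart G) (next_dart G h) d.
  by rewrite (fconnect_next_dart (next_dart_rot hv)).
move/iter_findex => <-; rewrite -iterSr.
apply: connect_trans (walk _) (crossed _ _ _).
  by move=> i _; apply: (none _ _ hv); apply: iter_next_dart_rot.
by apply: (none _ _ hv); apply: iter_next_dart_rot.
Qed.

Let up_hom x y : x \in points H -> rH x y -> connect rG (up x) (up y).
Proof.
have arc c d : vertex_arc H c d -> connect rG (up (inl c)) (up (inl d)).
  case: c d => [h z] [d w] /existsP[v /and4P[/= hv /eqP -> /eqP -> /eqP ->]].
  move: hv; rewrite !dirE !rotE mem_filter => /andP[kh hv].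
  rewrite -addNb !addbK; have := first_dartP h.
  rewrite (first_dart_filter hv kh) => -[n [-> nP]]; exact: walk.
case: x y => [c|//] [d|//]; rewrite inE esetE inE => /andP[cB _].
case/or3P=> [|/arc//|/arc]; last by rewrite rG_sym.
case: c d cB => [[e b] z] [[e' b'] z'] cB /and3P[/= /eqP <- bb' /eqP <-].
have -> : b' = ~~ b by move: bb'; case: (b); case: (b').
rewrite /= in cB; apply: connect1; rewrite /state_rel /invol_rel /= ffunE (negPf cB) /=.
apply/orP; right; apply/eqP; congr (inl (_, _, _)); first by rewrite addbT.
by rewrite /twisted /= -addbA; congr (_ (+) _); case: (_ \in C); case: (b).
Qed.

Let up_points x : x \in points H -> up x \in points G.
Proof.
case: x => [[h z]|v]; rewrite !inE ?esetE ?inE ?vsetE => /andP[] //= hv.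
case Er: (rot G v) => [|d p] _ /=; first by rewrite hv Er.
by apply: (@rot_edge _ _ _ v); rewrite Er mem_head.
Qed.

Let down_points x : x \in points G -> down x \in points H.
Proof.
case: x => [[h z]|v]; rewrite inE /= => hE; last first.
  by rewrite inE vsetE rotE; case/andP: hE => -> /eqP ->.
case: ifP => [kh|nk]; first by rewrite inE /= esetE inE hE -/(kept h) kh.
have [v hv] := edge_rot hE; rewrite /head_point.
have := first_dartP h; case Ed: first_dart => [d|] dP.
  have : d \in filter kept (orbit (next_dart G) (next_dart G h)).
    by move: Ed; rewrite /first_dart; case: filter => //= a l [->]; rewrite mem_head.
  rewrite mem_filter -fconnect_orbit (fconnect_next_dart (next_dart_rot hv)).
  by case/andP => kd /rot_edge dE; rewrite inE /= esetE inE dE andbT.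
rewrite (dart_vertexE hv) inE vsetE (rot_vset hv) rotE -size_eq0 size_filter /=.
by rewrite -leqn0 leqNgt -has_count; apply/hasPn => d; apply: dP.
Qed.

Let up_down x : x \in points G -> connect rG x (up (down x)).
Proof.
case: x => [[h z]|v]; rewrite inE /= => hE; last first.
  by case/andP: hE => _ /eqP ->.
case: ifP => [kh|/negbT nk]; first by rewrite /= addbK.
exact: connect_trans (crossed _ _ nk) (up_head_point hE).
Qed.

Let down_up x : x \in points H -> down (up x) = x.
Proof.
case: x => [[h z]|v]; rewrite !inE ?esetE ?inE ?vsetE => /andP[hv] /=.
  by move=> _; rewrite -/(kept h) [kept h]hv addbK.
rewrite rotE => /eqP Ef.
have nk d : d \in rot G v -> ~~ kept d.
  by move=> dv; apply/negP => kd; have : d \in [::] by rewrite -Ef mem_filter kd.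
case Er: (rot G v) => [|d p] //=.
have dv : d \in rot G v by rewrite Er mem_head.
rewrite (negPf (nk d dv)) /head_point (dart_vertexE dv).
have := first_dartP d; case Ed: first_dart => [d'|//] _.
have : d' \in filter kept (orbit (next_dart G) (next_dart G d)).
  by move: Ed; rewrite /first_dart; case: filter => //= a l [->]; rewrite mem_head.
rewrite mem_filter -fconnect_orbit (fconnect_next_dart (next_dart_rot dv)).
by case/andP => kd /nk; rewrite kd.
Qed.

(** [up] and [down] are mutually inverse up to connection: a corner of the
    minor is kept in place, and a corner of a deleted edge slides along its
    vertex to the first segment left, or to the vertex itself if nothing is
    left there. *)
Lemma nb_boundary_minor : nb_boundary H = nb_circles G s.
Proof.
rewrite nb_boundary_classes; apply/eqP; rewrite eqn_leq; apply/andP; split.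
  apply: (@leq_nb_classes _ _ _ _ _ _ down) => //.
  - by move=> x y; apply: state_rel_points.
  - by move=> x xH; exists (up x); rewrite ?up_points ?down_up.
apply: (@leq_nb_classes _ _ _ _ _ _ up) => //.
- by move=> x y; apply: boundary_point_rel_points.
- by move=> x xG; exists (down x); rewrite ?down_points ?up_down.
Qed.


End Minor.

(** * Circles and connected components *)

Section Components.
Variables (V E : finType) (G : ribbon_graph V E).
Local Notation point := (point V E).

Lemma adj_sym : connect_sym (adj G).
Proof.
apply: sym_connect_sym => u v; apply/existsP/existsP => -[[e b] /andP[hu hv]];
  by exists (e, ~~ b); rewrite /= negbK hu hv.
Qed.

Lemma adj_vset u v : adj G u v -> (u \in vset G) = (v \in vset G).
Proof. by case/existsP=> h /andP[/rot_vset -> /rot_vset ->]. Qed.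

Lemma nb_components_classes : nb_components G = nb_classes (adj G) (vset G).
Proof.
rewrite /nb_components n_comp_classes; first by congr nb_classes; apply/setP=> v; rewrite inE.
- exact: adj_sym.
- by move=> u v; apply: adj_vset.
Qed.

Definition first_point (v : V) : point :=
  if rot G v is h :: _ then inl (h, true) else inr v.

Lemma first_pointP v h : h \in rot G v ->
  exists2 d, first_point v = inl (d, true) & d \in rot G v.
Proof.
by rewrite /first_point; case: (rot G v) => // d p _; exists d; rewrite ?mem_head.
Qed.

Lemma first_point_points v : v \in vset G -> first_point v \in points G.
Proof.
move=> vG; case Er: (rot G v) => [|h p].
  by rewrite /first_point Er inE vG Er.
have hv : h \in rot G v by rewrite Er mem_head.
by have [d -> /rot_edge dE] := first_pointP hv; rewrite inE.
Qed.

(** A circle stays in one component, and every component carries a circle. *)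
Lemma leq_components_circles s : nb_components G <= nb_circles G s.
Proof.
rewrite nb_components_classes.
case: (pickP (mem (vset G))) => [v0 _|vG0]; last first.
  suff -> : vset G = set0 by rewrite /nb_classes imset0 cards0.
  by apply/setP=> v; rewrite inE -[LHS]/(mem (vset G) v) vG0.
pose h (x : point) : V :=
  match x with inl c => odflt v0 (dart_vertex G c.1) | inr v => v end.
apply: (@leq_nb_classes _ _ _ _ _ _ h).
- exact: adj_sym.
- exact: state_rel_sym.
- by move=> x y; apply: state_rel_points.
- case=> [[d y]|v] z; rewrite inE /= => dE; last by case/orP=> /eqP ->.
  have [v dv] := edge_rot dE; rewrite (dart_vertexE dv).
  case/orP=> /eqP ->.
    rewrite /arc_flip; case: ifP => _ /=; first by rewrite (dart_vertexE (next_dart_rot dv)).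
    suff pv : prev_dart G d \in rot G v by rewrite (dart_vertexE pv).
    by rewrite /prev_dart (dart_vertexE dv) mem_prev.
  case: d dE dv => e b eE dv /=; case: (s e).1; last by rewrite addbF (dart_vertexE dv).
  rewrite addbT; have [w dw] := @edge_rot _ _ G (e, ~~ b) eE.
  rewrite (dart_vertexE dw) /=; apply: connect1; apply/existsP; exists (e, b).
  by rewrite dv.
- move=> v vG; exists (first_point v); first exact: first_point_points.
  case Er: (rot G v) => [|d p]; first by rewrite /first_point Er.
  have dv : d \in rot G v by rewrite Er mem_head.
  by have [d' -> d'v] := first_pointP dv; rewrite /h (dart_vertexE d'v).
Qed.

(** If no edge meets two circles then a circle can be followed across edges
    and around vertices, hence fills its component. *)
Lemma circles_eq_components s :
  (forall e, e \in eset G -> forall x y,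
     connect (state_rel G s) (edge_corner V e x) (edge_corner V e y)) ->
  nb_circles G s = nb_components G.
Proof.
move=> ec; apply/eqP; rewrite eqn_leq leq_components_circles andbT.
have cc h y y' : h.1 \in eset G -> connect (state_rel G s) (inl (h, y)) (inl (h, y')).
  by case: h => e b eE; apply: (ec e eE (b, y) (b, y')).
have vc v h d y y' : h \in rot G v -> d \in rot G v ->
    connect (state_rel G s) (inl (h, y)) (inl (d, y')).
  move=> hv; rewrite -(fconnect_next_dart hv) => /iter_findex <-.
  elim: (findex _ _ _) y' => [|n IHn] y'; first exact: cc (rot_edge hv).
  have := iter_next_dart_rot n hv; rewrite iterS; move: (iter n _ h) IHn => d' IHn d'v.
  apply: connect_trans (IHn (~~ dir G d')) _.
  apply: (@connect_trans _ _ (inl (next_dart G d', dir G (next_dart G d')))).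
    by apply: connect1; rewrite /state_rel /invol_rel /arc_flip eqxx eqxx.
  by apply: cc; rewrite next_dart_edge; apply: rot_edge d'v.
rewrite nb_components_classes; apply: (@leq_nb_classes _ _ _ _ _ _ first_point).
- exact: state_rel_sym.
- exact: adj_sym.
- by move=> u v uG /adj_vset <-.
- move=> u v _ /existsP[[e b] /andP[/= hu hv]].
  have [d -> du] := first_pointP hu; have [d' -> dv] := first_pointP hv.
  apply: connect_trans (vc u _ (e, b) _ true du hu) _.
  apply: connect_trans (vc v _ _ true _ hv dv).
  exact: (ec e (rot_edge hu) (b, true) (~~ b, true)).
- case=> [[h y]|v]; rewrite inE /=.
    move=> /edge_rot[v hv]; exists v; first exact: rot_vset hv.
    by have [d -> dv] := first_pointP hv; apply: vc hv dv.
  by case/andP=> vG /eqP Er; exists v; rewrite /first_point ?Er.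
Qed.

End Components.

(** * Quasi-trees *)

Section QuasiTrees.
Variables (V E : finType) (G H : ribbon_graph V E).
Local Notation point := (point V E).
Hypothesis vsetE : vset H = vset G.
Hypothesis rot_sub : forall v, {subset rot H v <= rot G v}.

Let point_component (x : point) : {set V} :=
  match x with
  | inl c => if dart_vertex H c.1 is Some v then component G v else set0
  | inr v => component G v
  end.

Let adj_sub u v : adj H u v -> connect (adj G) u v.
Proof.
case/existsP=> h /andP[hu hv]; apply: connect1; apply/existsP; exists h.
by rewrite !rot_sub.
Qed.

Let component_eq u v : connect (adj G) u v -> component G u = component G v.
Proof.
move=> c; apply/setP=> w; rewrite !inE; apply: same_connect c _.
exact: adj_sym.
Qed.

Let component_eqP u v : component G u = component G v <-> connect (adj G) u v.
Proof.
split; last exact: component_eq.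
by move/setP/(_ v); rewrite !inE connect0.
Qed.

Let opposite e b u v : (e, b) \in rot H u -> (e, ~~ b) \in rot H v ->
  component G u = component G v.
Proof.
move=> hu hv; apply: component_eq; apply: adj_sub; apply/existsP; exists (e, b).
by rewrite hu.
Qed.

Let point_component_rel x y :
  boundary_point_rel H x y -> point_component x = point_component y.
Proof.
have arc c d : vertex_arc H c d -> point_component (inl c) = point_component (inl d).
  case/existsP=> v /and4P[cv /eqP dE _ _] /=.
  by rewrite (dart_vertexE cv) (@dart_vertexE _ _ _ _ v) // dE mem_next.
case: x y => [c|//] [d|//] /or3P[|/arc//|/arc//].
case: c d => [[e b] z] [[e' b'] z'] /and3P[/= /eqP <- bb' /eqP _].
have -> : b' = ~~ b by move: bb'; case: (b); case: (b').
case: (dart_vertexP H (e, b)) => [u hu eE|eE];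
  case: (dart_vertexP H (e, ~~ b)) => [v hv eE'|eE'] //.
- exact: opposite hu hv.
- by rewrite eE in eE'.
- by rewrite eE' in eE.
Qed.

(** In an edge subgraph [H], an edge with one end in a component of [G] has both
    ends there. *)
Let inner_edgesE v h w : h \in rot H w ->
  (h.1 \in inner_edges H (component G v)) = (component G w == component G v).
Proof.
move=> hw; rewrite inE (rot_edge hw) /=; apply/forallP/eqP => [/(_ h.2)|Ew b].
  case/exists_inP=> u; rewrite inE -surjective_pairing => vu hu.
  by rewrite (rotation_inj hw hu) (component_eq vu).
have [u hu] : exists u, (h.1, b) \in rot H u by apply: edge_rot; apply: rot_edge hw.
apply/exists_inP; exists u => //; rewrite inE; apply/component_eqP; rewrite -Ew.
case: h hw hu => e b' /= hw hu; case: (eqVneq b b') => [Eb|nb].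
  by rewrite Eb in hu; rewrite (rotation_inj hw hu).
by apply: opposite hw _; rewrite (_ : ~~ b' = b) //; move: nb; case: (b) ; case: (b').
Qed.

Let K v := restrict H (component G v).

Let restrict_rotE v w :
  rot (K v) w = if component G w == component G v then rot H w else [::].
Proof.
rewrite /= /restrict_rot inE -(adj_sym G).
have -> : connect (adj G) w v = (component G w == component G v).
  by apply/idP/eqP => /component_eqP.
case: eqP => // Ew; apply/all_filterP/allP => h hw.
by rewrite (inner_edgesE _ hw); apply/eqP.
Qed.

Let points_restrict v :
  points (K v) = [set x in points H | point_component x == component G v].
Proof.
apply/setP=> -[[h y]|w]; rewrite !inE /=; last first.
  rewrite -[restrict_rot _ _ _]/(rot (K v) w) restrict_rotE -(adj_sym G).
  have -> : connect (adj G) w v = (component G w == component G v).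
    by apply/idP/eqP => /component_eqP.
  by case: eqP => _; rewrite ?andbT ?andbF.
case: dart_vertexP => [w hw hE|hE]; last by rewrite (negPf hE).
by rewrite hE /= -(inner_edgesE v hw) inE hE.
Qed.

Let boundary_restrict v x y : x \in points (K v) ->
  boundary_point_rel (K v) x y = boundary_point_rel H x y.
Proof.
have arc c d : vertex_arc (K v) c d
    = vertex_arc H c d && (point_component (inl c) == component G v).
  apply/existsP/andP=> [[w /and4P[]]|[/existsP[w /and4P[cw dE c2 d2]]]].
    rewrite restrict_rotE; case: eqP => // Ew cw dE c2 d2; split.
      by apply/existsP; exists w; apply/and4P.
    by rewrite /= (dart_vertexE cw) Ew.
  rewrite [point_component _]/= (dart_vertexE cw) => Ew; exists w.
  by rewrite restrict_rotE Ew cw dE c2 d2.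
rewrite points_restrict inE => /andP[_ xv]; case: x xv y => [c|//] xv [d|//] /=.
rewrite /boundary_rel !arc xv andbT; congr [|| _, _ | _].
case cd: (vertex_arc H d c) => //=; rewrite -(eqP xv).
apply/eqP; apply: (@point_component_rel (inl d) (inl c)).
by rewrite /= /boundary_rel cd !orbT.
Qed.

Let nb_boundary_restrict v : nb_boundary (K v) =
  nb_classes (boundary_point_rel H)
    [set x in points H | point_component x == component G v].
Proof.
rewrite nb_boundary_classes -points_restrict.
have sK := boundary_point_rel_sym (K v); have sH := boundary_point_rel_sym H.
apply/eqP; rewrite eqn_leq; apply/andP; split; apply: (@leq_nb_classes _ _ _ _ _ _ id) => //.
- move=> x y xv; rewrite -(boundary_restrict _ xv); apply: boundary_point_rel_points xv.
- by move=> x y xv; rewrite -(boundary_restrict _ xv); apply: connect1.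
- by move=> x xv; exists x.
- by move=> x y; apply: boundary_point_rel_points.
- by move=> x y xv; rewrite (boundary_restrict _ xv); apply: connect1.
- by move=> x xv; exists x.
Qed.

(** The circles of [H] are distributed among the components of [G], each of which
    carries at least one of them. *)
Lemma quasi_tree_components :
  [forall v in vset G, quasi_tree (restrict H (component G v))]
  = (nb_boundary H == nb_components G).
Proof.
pose rt := fingraph.root (boundary_point_rel H).
have sH := boundary_point_rel_sym H.
pose comps := [set component G v | v in vset G].
pose circles := [set rt x | x in points H].
have pc x y : connect (boundary_point_rel H) x y -> point_component x = point_component y.
  case/connectP=> p; elim: p x => [|z p IHp] x /=; first by move=> _ ->.
  by case/andP=> /point_component_rel -> pz /(IHp z pz).
have rt_pc x : point_component (rt x) = point_component x.
  by apply/esym/pc; apply: connect_root.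
have pcomp x : x \in points H -> point_component x \in comps.
  case: x => [[h y]|v]; rewrite inE /= => hE.
    by have [v hv] := edge_rot hE; rewrite (dart_vertexE hv) imset_f // -vsetE (rot_vset hv).
  by rewrite imset_f // -vsetE; case/andP: hE.
have nK v : nb_boundary (K v) = \sum_(x in circles | point_component x == component G v) 1.
  rewrite nb_boundary_restrict sum1_card /nb_classes; apply: eq_card => z.
  rewrite unfold_in /=; apply/imsetP/andP => [[x]|[/imsetP[x xH ->] Ex]].
    rewrite inE => /andP[xH Ex] ->; split; first exact: imset_f.
    by rewrite rt_pc.
  by exists x => //; rewrite inE xH -rt_pc.
have n1 v : v \in vset G -> 0 < nb_boundary (K v).
  move=> vG; rewrite nb_boundary_restrict card_gt0; apply/set0Pn.
  exists (rt (first_point H v)); apply: imset_f; rewrite inE first_point_points ?vsetE //=.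
  apply/eqP; case Er: (rot H v) => [|d p]; first by rewrite /first_point Er.
  have dv : d \in rot H v by rewrite Er mem_head.
  by have [d' -> d'v] := first_pointP dv; rewrite /= (dart_vertexE d'v).
have -> : nb_boundary H = \sum_(C in comps)
    \sum_(x in circles | point_component x == C) 1.
  rewrite nb_boundary_classes /nb_classes -sum1_card.
  rewrite (partition_big point_component (mem comps)) //.
  by move=> _ /imsetP[x xH ->]; rewrite rt_pc; apply: pcomp.
have -> : nb_components G = \sum_(C in comps) 1.
  rewrite sum1_card nb_components_classes /nb_classes; apply: card_imset_kernel => u v _ _.
  rewrite component_eqP; split=> [/eqP|c].
    by rewrite root_connect //; apply: adj_sym.
  by apply/eqP; rewrite root_connect //; apply: adj_sym.
rewrite eq_sym; set S := (X in _ == X).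
have := @leqif_sum _ (mem comps)
  (fun C => \sum_(x in circles | point_component x == C) 1 == 1) (fun=> 1)
  (fun C => \sum_(x in circles | point_component x == C) 1).
case=> [C /imsetP[v vG ->]|_ ->].
  by rewrite -nK; split; [apply: n1 | rewrite eq_sym].
apply/forall_inP/forall_inP => [h C /imsetP[v vG ->]|h v vG].
  by rewrite -nK; apply: h.
by rewrite /quasi_tree nK; apply: h; apply: imset_f.
Qed.

End QuasiTrees.

(** * Quasi-tree states *)

Section QuasiTreeStates.
Variables (V E : finType) (G : ribbon_graph V E).
Implicit Types (s : state E) (e : E) (z : bool * bool) (A B C X : {set E}).

Definition proper_state s := forall e, s e != (false, false).

Definition tree_state s : bool := nb_circles G s == nb_components G.

Lemma set_state_id s e : set_state s e (s e) = s.
Proof. by apply/ffunP=> e'; rewrite ffunE; case: eqP => [->|]. Qed.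

Lemma set_stateE s s' e z :
  s' e = z -> (forall e', e' != e -> s' e' = s e') -> s' = set_state s e z.
Proof.
by move=> se so; apply/ffunP=> e'; rewrite ffunE; case: eqVneq => [->|/so].
Qed.

(** Of the three states of [e], one has an extra circle and the other two
    have the same number of circles; so an even number of them, two or none,
    reach the minimum. *)
Lemma tree_state_kadd s e z z' : e \in eset G -> proper_state s ->
  z != (false, false) -> z' != (false, false) -> z != z' ->
  tree_state (set_state s e (kadd z z'))
  = tree_state (set_state s e z) (+) tree_state (set_state s e z').
Proof.
move=> eE s0 z0 z0' zz'; have [m m0 [n mP]] := circles_trichotomy eE s0.
have zz0 : kadd z z' != (false, false).
  by move: zz'; case: (z) => -[] []; case: (z') => -[] [].
have [E1 _] := mP z z0; have [E2 _] := mP z' z0'; have [E3 _] := mP _ zz0.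
have := leq_components_circles G (set_state s e z).
have := leq_components_circles G (set_state s e z').
rewrite /tree_state E1 E2 E3; move: (nb_components G) => k.
move: z0 z0' zz' m0; clear.
by case: z => -[] []; case: z' => -[] []; case: m => -[] [] //= _ _ _ _; lia.
Qed.

Lemma set_state_leq s e z z' : e \in eset G -> proper_state s ->
  z != (false, false) -> z' != (false, false) ->
  nb_circles G (set_state s e z) <= (nb_circles G (set_state s e z')).+1.
Proof.
move=> eE s0 z0 z0'; have [m m0 [n mP]] := circles_trichotomy eE s0.
have [-> _] := mP z z0; have [-> _] := mP z' z0'; lia.
Qed.

(** If every edge were in a state other than the one with an extra circle, then
    no edge would meet two circles, and there would be no more circles than
    components. *)
Lemma exists_merging_edge s : proper_state s -> nb_components G < nb_circles G s ->
  exists2 e, e \in eset G & forall z, z != (false, false) -> z != s e ->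
    (nb_circles G (set_state s e z)).+1 = nb_circles G s.
Proof.
move=> s0 gt; pose merging e := [forall z : bool * bool, (z != (false, false)) ==>
  (z != s e) ==> ((nb_circles G (set_state s e z)).+1 == nb_circles G s)].
case: (pickP [pred e in eset G | merging e]) => [e /andP[eE /forallP me]|none].
  by exists e => // z z0 zs; have /implyP/(_ z0)/implyP/(_ zs)/eqP := me z.
suff Ek : nb_circles G s = nb_components G by rewrite Ek ltnn in gt.
apply: circles_eq_components => e eE.
have [m m0 [n mP]] := circles_trichotomy eE s0.
case: (eqVneq (s e) m) => [Em|nm]; last first.
  by have [_ /(_ nm)] := mP _ (s0 e); rewrite set_state_id.
have := none e; rewrite /= eE /= => /negbT/negP[]; apply/forallP=> z.
apply/implyP=> z0; apply/implyP=> zs.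
have [-> _] := mP z z0; have := mP _ (s0 e); rewrite set_state_id Em eqxx => -[-> _].
by rewrite -Em (negPf zs) addn0 addn1.
Qed.

(** * Set systems given by quasi-tree states *)

(** [on e] and [off e] are the states of the edge [e] when it belongs to [X] and
    when it does not. *)
Definition on_off_state (on off : E -> bool * bool) X : state E :=
  [ffun e => if e \in eset G then (if e \in X then on e else off e)
             else (true, false)].

Definition on_off_proper (on off : E -> bool * bool) : Prop :=
  forall e, [&& on e != (false, false), off e != (false, false) & on e != off e].

(** Holds for the delta-matroid of [G] and is preserved by twists and loop
    complementations, which act edgewise on [on] and [off]. *)
Definition encoded_by (D : set_system E) (on off : E -> bool * bool) : Prop :=
  ground D = eset G /\
  forall X, (X \in feasible D)
    = (X \subset eset G) && tree_state (on_off_state on off X).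

Lemma on_off_state_proper on off X :
  on_off_proper on off -> proper_state (on_off_state on off X).
Proof.
move=> h e; rewrite ffunE; case: ifP => // _; have /and3P[? ? _] := h e.
by case: ifP.
Qed.

Lemma encoded_by_ext D on off on' off' : on =1 on' -> off =1 off' ->
  encoded_by D on off -> encoded_by D on' off'.
Proof.
move=> onE offE [gE fE]; split=> // X; rewrite fE; congr (_ && tree_state _).
by apply/ffunP=> e; rewrite !ffunE onE offE.
Qed.

Lemma symdiffK (A : {set E}) : involutive (symdiff A).
Proof.
by move=> Y; apply/setP=> x; rewrite !inE; case: (x \in A); case: (x \in Y).
Qed.

Lemma encoded_by_twist D on off A : encoded_by D on off ->
  encoded_by (twist D A) (fun e => if e \in A then off e else on e)
                         (fun e => if e \in A then on e else off e).
Proof.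
move=> [gE fE]; split=> // X; pose A' := A :&: eset G.
have -> : (X \in feasible (twist D A)) = (symdiff A' X \in feasible D).
  rewrite /= /twist_feasible gE -/A'; apply/imsetP/idP => [[Y YD ->]|h].
    by rewrite (symdiffK A').
  by exists (symdiff A' X); rewrite ?(symdiffK A').
rewrite fE; congr (_ && tree_state _).
  apply/subsetP/subsetP => h x; move: (h x); rewrite /A' !inE.
    by case: (x \in X); case: (x \in A); case: (x \in eset G) => //= h1 _; apply: h1.
  by case: (x \in X); case: (x \in A); case: (x \in eset G) => //= h1 _; apply: h1.
apply/ffunP=> e; rewrite !ffunE /A' !inE; case: (e \in eset G) => //.
by case: (e \in A); case: (e \in X).
Qed.

(** When [e] is in [X], feasibility of [X] after the loop complementation is the
    sum modulo 2 of those of [X] and [X :\ e] before, which [tree_state_kadd]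
    turns into the third state of [e]. *)
Lemma encoded_by_loopc D on off e : e \in eset G -> on_off_proper on off ->
  encoded_by D on off ->
  encoded_by (loopc D e)
    (fun e' => if e' == e then kadd (on e) (off e) else on e') off.
Proof.
move=> eE prop [gE fE]; split=> // X.
have -> : (X \in feasible (loopc D e))
    = (X \in feasible D) (+) ((e \in X) && (X :\ e \in feasible D)).
  rewrite /= /loopc_feasible gE eE in_setU !in_setD.
  have -> : (X \in [set e |: X0 | X0 in feasible D & e \notin X0])
      = (e \in X) && (X :\ e \in feasible D).
    apply/imsetP/andP => [[Y]|[eX XD]].
      rewrite inE => /andP[YD eY] ->; rewrite setU11; split=> //.
      by rewrite setU1K.
    by exists (X :\ e); rewrite ?inE ?eqxx ?andbT ?setD1K.
  by case: (X \in feasible D); case: (e \in X); case: (X :\ e \in feasible D).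
rewrite !fE; case: (boolP (e \in X)) => eX /=; last first.
  rewrite addbF; congr (_ && tree_state _); apply/ffunP=> e'; rewrite !ffunE.
  by case: ifP => // _; case: ifP => // e'X; case: eqP => // Ee; rewrite -Ee e'X in eX.
have -> : (X :\ e \subset eset G) = (X \subset eset G).
  by rewrite -{2}(setD1K eX) subUset sub1set eE.
case: (X \subset _) => //=.
have /and3P[on0 off0 onoff] := prop e; pose s := on_off_state on off X.
have -> : on_off_state on off (X :\ e) = set_state s e (off e).
  apply: set_stateE => [|e' ne]; rewrite !ffunE !inE ?eqxx ?eE //=.
  by rewrite ne.
have -> : on_off_state on off X = set_state s e (on e).
  by apply: set_stateE => //; rewrite ffunE eE eX.
rewrite -tree_state_kadd //; last exact: on_off_state_proper.
congr tree_state; apply/esym/set_stateE => [|e' ne]; rewrite !ffunE ?eqxx ?eE ?eX //.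
by rewrite (negPf ne).
Qed.

Lemma encoded_by_loopc_set D on off A : A \subset eset G -> on_off_proper on off ->
  encoded_by D on off ->
  encoded_by (loopc_set D A)
    (fun e => if e \in A then kadd (on e) (off e) else on e) off.
Proof.
move=> AE prop DE; rewrite /loopc_set.
suff H l : uniq l -> {subset l <= eset G} -> encoded_by (foldl (@loopc E) D l)
    (fun e => if e \in l then kadd (on e) (off e) else on e) off.
  apply: encoded_by_ext (H _ (enum_uniq _) _) => // [e|e]; first by rewrite mem_enum.
  by rewrite mem_enum => /(subsetP AE).
elim: l D on prop DE => [|a l IHl] D on prop DE //= /andP[al ul] lE.
have prop' : on_off_proper (fun e => if e == a then kadd (on a) (off a) else on e) off.
  move=> e; case: (eqVneq e a) => [->|_ //]; have := prop a.
  by case: (on a) => -[] []; case: (off a) => -[] [].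
have aE : a \in eset G by apply: lE; rewrite mem_head.
apply: encoded_by_ext (IHl _ _ prop' (encoded_by_loopc aE prop DE) ul _) => // [e|e el].
  by rewrite inE; case: (eqVneq e a) => [->|_] //=; rewrite (negPf al).
by apply: lE; rewrite inE el orbT.
Qed.

(** * Rank *)

(** Each element of [X] accounts for one change of state, which removes at most
    one circle. *)
Lemma leq_circles_on_off on off X : on_off_proper on off -> X \subset eset G ->
  nb_circles G (on_off_state on off set0)
  <= nb_circles G (on_off_state on off X) + #|X|.
Proof.
move=> prop; move: {2}#|X| (erefl #|X|) => n; elim: n X => [|n IHn] X.
  by move/eqP; rewrite cards_eq0 => /eqP-> _; rewrite cards0 addn0.
move=> cX XE; have /card_gt0P[e eX] : 0 < #|X| by rewrite cX.
have eE := subsetP XE e eX; have cX' : #|X :\ e| = n.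
  by move: cX; rewrite (cardsD1 e) eX => -[].
have := IHn _ cX' (subset_trans (subsetDl _ _) XE); rewrite cX cX' => IH.
suff : nb_circles G (on_off_state on off (X :\ e))
    <= (nb_circles G (on_off_state on off X)).+1 by lia.
pose s := on_off_state on off X; have /and3P[on0 off0 _] := prop e.
have -> : on_off_state on off (X :\ e) = set_state s e (off e).
  apply: set_stateE => [|e' ne]; rewrite !ffunE !inE ?eqxx ?eE //=.
  by rewrite ne.
have -> : on_off_state on off X = set_state s e (on e).
  by apply: set_stateE => //; rewrite ffunE eE eX.
by apply: set_state_leq => //; apply: on_off_state_proper.
Qed.

(** Greedy descent: as long as there are too many circles, change the state of
    an edge that meets two of them.  No edge comes up twice, since undoing its
    change would also remove a circle, and then fewer changes would have removed
    more circles than [leq_circles_on_off] allows. *)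
Lemma exists_tree_on_off on off : on_off_proper on off ->
  exists X, [/\ X \subset eset G, tree_state (on_off_state on off X) &
    nb_components G + #|X| = nb_circles G (on_off_state on off set0)].
Proof.
move=> prop; set N := nb_circles G _; pose s := on_off_state on off.
suff H n X : X \subset eset G -> nb_circles G (s X) = nb_components G + n ->
    nb_circles G (s X) + #|X| = N -> exists X, [/\ X \subset eset G, tree_state (s X) &
    nb_components G + #|X| = N].
  apply: (H (N - nb_components G) set0); first exact: sub0set.
    by rewrite subnKC // leq_components_circles.
  by rewrite cards0 addn0.
elim: n X => [|n IHn] X XE Xn XN.
  rewrite addn0 in Xn; exists X; split=> //; last by rewrite -Xn.
  by rewrite /tree_state Xn.
have gt : nb_components G < nb_circles G (s X) by lia.
have [e eE eP] := exists_merging_edge (on_off_state_proper X prop) gt.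
have /and3P[on0 off0 onoff] := prop e.
case: (boolP (e \in X)) => eX; last first.
  have E1 : s (e |: X) = set_state (s X) e (on e).
    apply: set_stateE => [|e' ne]; rewrite !ffunE !inE ?eqxx ?eE //=.
    by rewrite (negPf ne).
  have := eP (on e) on0; rewrite -/(s X) -E1 ffunE eE (negPf eX) => /(_ onoff) E2.
  apply: (IHn (e |: X)); rewrite ?subUset ?sub1set ?eE ?cardsU1 ?eX //.
    by apply/eqP; rewrite -eqSS E2 Xn addnS.
  by rewrite add1n addnS -addSn E2.
have E1 : s (X :\ e) = set_state (s X) e (off e).
  apply: set_stateE => [|e' ne]; rewrite !ffunE !inE ?eqxx ?eE //=.
  by rewrite ne.
have := eP (off e) off0; rewrite -/(s X) -E1 ffunE eE eX eq_sym => /(_ onoff) E2.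
have := leq_circles_on_off prop (subset_trans (subsetDl X [set e]) XE).
rewrite -/(s (X :\ e)) -/N; move: XN; rewrite (cardsD1 e) eX add1n addnS -E2 => <-; lia.
Qed.

Lemma leq_bigmin (T : eqType) (r : seq T) (P : pred T) (F : T -> nat) m x :
  x \in r -> P x -> \big[minn/m]_(i <- r | P i) F i <= F x.
Proof.
elim: r => // a r IHr; rewrite inE big_cons => /predU1P[<- ->|/IHr h /h {}h].
  exact: geq_minl.
by case: ifP => // _; apply: leq_trans (geq_minr _ _) h.
Qed.

Lemma min_rank_circles D on off : on_off_proper on off -> encoded_by D on off ->
  nb_components G + min_rank D = nb_circles G (on_off_state on off set0).
Proof.
move=> prop [gE fE]; have [X [XE Xt XN]] := exists_tree_on_off prop.
rewrite -XN; congr (_ + _); apply/eqP; rewrite eqn_leq; apply/andP; split.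
  by apply: leq_bigmin; rewrite ?mem_index_enum // fE XE.
apply: (big_ind (fun n => #|X| <= n)).
- by rewrite gE; apply: subset_leq_card.
- by move=> m n; rewrite leq_min => -> ->.
move=> Y; rewrite fE => /andP[YE /eqP Yt].
by have := leq_circles_on_off prop YE; rewrite -XN Yt; lia.
Qed.

Lemma encoded_by_delta_matroid :
  encoded_by (delta_matroid_of G) (fun=> (true, false)) (fun=> (false, true)).
Proof.
split=> // F; rewrite inE powersetE; apply: andb_id2l => FE.
rewrite quasi_tree_components //; last by move=> v h; rewrite mem_filter => /andP[].
rewrite /tree_state (@nb_boundary_minor _ _ G _ (eset G :\: F) set0) //; last first.
  by move=> h; rewrite inE addbF.
congr (nb_circles G _ == _); apply/ffunP=> e; rewrite !ffunE !inE.
have := subsetP FE e; case: (e \in F) => [/(_ isT) -> //|_].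
by case: (e \in eset G).
Qed.

(** Start from the state of the empty set in the delta-matroid, in which every
    edge is deleted.  The twist by [A] turns the edges of [A] into untouched
    ones, and the dual pivot on [C] turns those of [C] into twisted ones: the
    first twist makes an edge outside of [X] untouched and one in [X] deleted,
    the loop complementation makes the latter twisted, and the second twist
    exchanges the two. *)
Lemma nb_boundary_min_rank A B C : ordered_partition3 (eset G) A B C ->
  nb_boundary (delete (partial_petrial G C) B)
  = nb_components G + min_rank (dual_pivot (twist (delta_matroid_of G) A) C).
Proof.
case/and4P=> /eqP ABC dAB dAC dBC.
have CE : C \subset eset G by rewrite -ABC subsetUr.
rewrite (@nb_boundary_minor _ _ G _ B C) //; last first.
  by move=> h /=; case: ifP; rewrite ?addbT ?addbF.
have enc1 := encoded_by_twist C (encoded_by_twist A encoded_by_delta_matroid).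
have := encoded_by_twist C (encoded_by_loopc_set CE _ enc1).
move=> /(_ _)/min_rank_circles ->.
- congr (nb_circles G _); apply/ffunP=> e; rewrite !ffunE inE -ABC !inE.
  have := disjointFr dAB (x := e); have := disjointFr dAC (x := e).
  have := disjointFr dBC (x := e).
  by case: (e \in A); case: (e \in B); case: (e \in C) => //= h1 h2 h3;
    by [have := h1 isT | have := h2 isT | have := h3 isT].
- by move=> e; case: (e \in A); case: (e \in C).
- by move=> e; case: (e \in A); case: (e \in C).
Qed.

End QuasiTreeStates.

Local Open Scope ring_scope.

Theorem proposition5p7 (R : comNzRingType) (V E : finType)
    (G : ribbon_graph V E) (alpha beta gamma : E -> R) :
  topological_transition G alpha beta gamma
  = 'X^(nb_components G) * transition (delta_matroid_of G) beta alpha gamma.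
Proof.
rewrite /topological_transition /transition mulr_sumr.
(* The untouched edges form the first block for the ribbon graph, but for the
   set system they are those of the twist, which form the second block. *)
pose swap (p : {set E} * {set E} * {set E}) := ((p.1.2, p.1.1), p.2).
have swapK : involutive swap by case=> [[]].
rewrite (reindex_inj (inv_inj swapK)) /=; apply: eq_big => [[[A B] C]|[[A B] C]] /=.
  by rewrite /ordered_partition3 (setUC B) disjoint_sym (andbC [disjoint B & C]).
move=> part; rewrite -scalerAr -exprD (nb_boundary_min_rank part).
by rewrite (mulrC (\prod_(e in B) _)).
Qed.
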